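(* For every integer $t\geq 4$, every graph that does not contain $K_t$ as a minor has a colouring with $2t-2$ colours such that for $t-1$ of the colours each monochromatic component has at most $t-4$ vertices, and for the other $t-1$ colours each monochromatic component is a path.
   Context: All graphs are finite and simple. Colourings need not be proper; a monochromatic component is a connected component of the subgraph induced by the vertices of one colour. *)

(* Defs.v *)
From mathcomp Require Import all_boot.

Set Implicit Arguments.
Unset Strict Implicit.
Unset Printing Implicit Defensive.

Record sgraph := SGraph {
  vertex :> finType;
  adj : rel vertex;
  adj_sym : symmetric adj;
  adj_irrefl : irreflexive adj
}.

Lemma neq_sym (T : eqType) : symmetric [rel x y : T | x != y].
Proof. by move=> x y /=; rewrite eq_sym. Qed.

Lemma neq_irrefl (T : eqType) : irreflexive [rel x y : T | x != y].
Proof. by move=> x /=; rewrite eqxx. Qed.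

Definition complete_graph (n : nat) : sgraph :=
  @SGraph 'I_n _ (@neq_sym 'I_n) (@neq_irrefl 'I_n).

Definition path_adj (n : nat) : rel 'I_n :=
  [rel i j : 'I_n | (i.+1 == j :> nat) || (j.+1 == i :> nat)].

Lemma path_adj_sym n : symmetric (@path_adj n).
Proof. by move=> i j; rewrite /path_adj /= orbC. Qed.

Lemma path_adj_irrefl n : irreflexive (@path_adj n).
Proof. by move=> i; rewrite /path_adj /= orbb eqn_leq ltnn. Qed.

Definition path_graph (n : nat) : sgraph :=
  SGraph (@path_adj_sym n) (@path_adj_irrefl n).

Definition isomorphic (G H : sgraph) : Prop :=
  exists f : G -> H, bijective f /\ forall x y, adj (f x) (f y) = adj x y.

(* A path has at least one vertex; a single vertex is a path. *)
Definition is_path (G : sgraph) : Prop :=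
  exists n, 0 < n /\ isomorphic G (path_graph n).

Section Induced.
Variables (G : sgraph) (A : {set G}).

Definition induced_adj : rel {x : G | x \in A} :=
  [rel x y | adj (val x) (val y)].

Lemma induced_adj_sym : symmetric induced_adj.
Proof. by move=> x y; apply: adj_sym. Qed.

Lemma induced_adj_irrefl : irreflexive induced_adj.
Proof. by move=> x; apply: adj_irrefl. Qed.

Definition induced : sgraph := SGraph induced_adj_sym induced_adj_irrefl.

(* The edges of G[A], as a relation on all of G, so that connectivity and
   components of G[A] are expressed with sets of vertices of G. *)
Definition adj_in : rel G := [rel x y in A | adj x y].

Definition connected_set : Prop :=
  A != set0 /\ {in A &, forall x y, connect adj_in x y}.

Definition components : {set {set G}} :=
  equivalence_partition (connect adj_in) A.

End Induced.

(* H is a minor of G: there is a model of H in G, i.e. pairwise disjoint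
   connected branch sets, with an edge of G between the branch sets of any two
   adjacent vertices of H. Contracting the branch sets in a subgraph of G then
   gives H. *)
Definition minor (H G : sgraph) : Prop :=
  exists B : H -> {set G},
    [/\ forall u, connected_set (B u),
        forall u v, u != v -> [disjoint B u & B v]
      & forall u v, adj u v ->
          exists x y, [/\ x \in B u, y \in B v & adj x y]].

Definition mono_components (G : sgraph) (K : finType) (c : G -> K) (k : K) :
    {set {set G}} :=
  components [set x | c x == k].

(* Main.v *)
Require Import Defs.
From mathcomp Require Import all_boot.
From mathcomp Require Import zify.

Set Implicit Arguments.
Unset Strict Implicit.
Unset Printing Implicit Defensive.

(** Remove from the graph, one after the other, connected sets H such that every
    connected set C avoiding the removed sets touches only pairwise touching ones;
    there are at most t - 2 of those, as together with C they form a clique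
    minor, so t - 1 colours suffice greedily for the removed sets.  The next
    H is chosen in a component C of the rest so as to contain a neighbour of each
    of the k <= t - 2 removed sets touched by C.  To keep H simple, it is grown
    from one terminal by adding a geodesic from each further terminal.  The
    first geodesic is an induced path; in each later one only the vertex at
    distance 1 sees the part already built.  The at most k - 2 vertices of that
    kind are red, and removing them from H leaves disjoint induced paths.  Splitting
    every colour into its red and non-red halves gives the 2t - 2 colours. *)
Section Graph.
Variable G : sgraph.
Implicit Types (A B C H X Y : {set G}) (P Q : {set {set G}}) (x y z : G).

(** * Connectedness inside a vertex set *)

Lemma adj_inE A x y : adj_in A x y = [&& x \in A, y \in A & adj x y].
Proof. by rewrite andbA. Qed.

Lemma connect_adj_in_sym A : connect_sym (adj_in A).
Proof. by apply: sym_connect_sym => x y; rewrite !adj_inE adj_sym andbCA. Qed.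

Lemma connect_adj_inS A B x y :
  A \subset B -> connect (adj_in A) x y -> connect (adj_in B) x y.
Proof.
move=> /subsetP sAB; apply: connect_sub x y => x y /andP[/andP[xA yA] xy].
by apply: connect1; rewrite adj_inE !sAB.
Qed.

Lemma connected_rooted A x :
  x \in A -> {in A, forall y, connect (adj_in A) x y} -> connected_set A.
Proof.
move=> xA conx; split; first by apply/set0Pn; exists x.
move=> y z yA zA; apply: connect_trans (conx z zA).
by rewrite connect_adj_in_sym conx.
Qed.

Lemma connected_set1 x : connected_set [set x].
Proof.
apply: (@connected_rooted _ x); first by rewrite set11.
by move=> y /set1P->; rewrite connect0.
Qed.

Lemma connected_set2 x y : adj x y -> connected_set [set x; y].
Proof.
move=> xy; apply: (@connected_rooted _ x); first by rewrite set21.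
move=> z /set2P[]->; rewrite ?connect0 //.
by apply: connect1; rewrite adj_inE set21 set22.
Qed.

Lemma connected_setU A B z : z \in A -> z \in B ->
  connected_set A -> connected_set B -> connected_set (A :|: B).
Proof.
move=> zA zB [_ conA] [_ conB]; apply: (@connected_rooted _ z).
  by rewrite inE zA.
move=> y /setUP[yA|yB].
  by apply: connect_adj_inS (conA _ _ zA yA); rewrite subsetUl.
by apply: connect_adj_inS (conB _ _ zB yB); rewrite subsetUr.
Qed.

(** Walking along a path from [x] to [y], some edge has to leave [p]. *)
Lemma connected_cut A (p : pred G) x y : connected_set A ->
  x \in A -> y \in A -> p x -> ~~ p y ->
  exists u v, [/\ u \in A, v \in A, adj u v, p u & ~~ p v].
Proof.
move=> [_ conA] xA yA px py; have /connectP[s + yE] := conA _ _ xA yA.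
rewrite {}yE {conA yA} in py *.
elim: s x xA px py => [|z s IHs] x xA px /=; first by rewrite px.
move=> npl /andP[/andP[/andP[_ zA] xz] zs].
have [pz|npz] := boolP (p z); last by exists x, z.
exact: IHs zs.
Qed.

(** A path in [A] from [x] only meets vertices reached from [x], so it survives in the subgraph that
    these induce. *)
Lemma component_of_connected A x : x \in A ->
  connected_set [set y in A | connect (adj_in A) x y].
Proof.
move=> xA; set C := [set _ in _ | _].
have xC : x \in C by rewrite inE xA connect0.
apply: (@connected_rooted _ x) => // y; rewrite inE => /andP[_ /connectP[s]].
suff step z : z \in C -> path (adj_in A) z s ->
    connect (adj_in C) z (last z s) by move=> /(step _ xC) + ->.
elim: s z => [|u s IHs] z zC /=; first by rewrite connect0.
move=> /andP[zu us]; have uC : u \in C.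
  move: zC zu; rewrite !inE => /andP[_ xz] zu; case/andP: (zu) => /andP[_ ->] _.
  exact: connect_trans xz (connect1 zu).
apply: connect_trans (IHs _ uC us); apply: connect1.
by case/andP: zu => _ zu; rewrite adj_inE zC uC.
Qed.

Lemma componentsP A C : C \in components A -> C \subset A /\ connected_set C.
Proof.
case/imsetP => x xA ->; split; last exact: component_of_connected.
by apply/subsetP => y; rewrite inE => /andP[].
Qed.

(** * Distances and geodesics *)

Lemma distance_to C H : connected_set C -> H \subset C -> H != set0 ->
  exists d : G -> nat,
    [/\ {in C, forall x, (d x == 0) = (x \in H)},
        {in C &, forall x y, adj x y -> d x <= (d y).+1}
      & {in C, forall x n, d x = n.+1 -> exists y, [/\ y \in C, adj x y & d y = n]}].
Proof.
move=> [_ conC] /subsetP sHC /set0Pn[r rH].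
(* [reach n x] says that some walk of [n] steps, each into [C], leads from [x] to [H]; on [C], [d x]
   will be the least such [n]. *)
pose fix reach (n : nat) (x : G) {struct n} :=
  if n is m.+1 then [exists y in C, adj x y && reach m y] else x \in H.
have reachable x : x \in C -> exists n, reach n x.
  move=> xC; have /connectP[s] := conC _ _ xC (sHC _ rH).
  elim: s x {xC} => [|y s IHs] x /=; first by move=> _ <-; exists 0.
  move=> /andP[/andP[/andP[_ yC] xy] ys] /(IHs _ ys)[n yn].
  by exists n.+1; apply/exists_inP; exists y; rewrite // xy.
have [d dP] : exists d : G -> nat, forall x, x \in C ->
    reach (d x) x /\ forall m, reach m x -> d x <= m.
  apply: (@fin_all_exists _ (fun=> nat) (fun x n => x \in C ->
    reach n x /\ forall m, reach m x -> n <= m)) => x.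
  have [xC|] := boolP (x \in C); last by exists 0.
  by have [n xn nmin] := ex_minnP (reachable x xC); exists n.
have lip x y : x \in C -> y \in C -> adj x y -> d x <= (d y).+1.
  move=> xC yC xy; apply: (dP x xC).2 => /=.
  by apply/exists_inP; exists y; rewrite // xy (dP y yC).1.
exists d; split=> // [x xC|x xC n dx].
  apply/eqP/idP => [dx|xH]; first by have := (dP x xC).1; rewrite dx.
  by apply/eqP; rewrite -leqn0; apply: (dP x xC).2.
have := (dP x xC).1; rewrite dx /= => /exists_inP[y yC /andP[xy yn]].
exists y; split=> //; apply/eqP; rewrite eqn_leq (dP y yC).2 //=.
by rewrite -ltnS -dx lip.
Qed.

(** Stepping down from [v] by one unit of [d] at a time gives a path with all distances different.
    As [d] changes by at most one along an edge, the path has no chords. *)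
Lemma geodesic_to C H v : connected_set C -> H \subset C -> H != set0 -> v \in C ->
  exists (d : G -> nat) X,
    [/\ [/\ {in C, forall x, (d x == 0) = (x \in H)},
            {in C &, forall x y, adj x y -> d x <= (d y).+1} & X \subset C],
        [/\ v \in X, connected_set X & exists2 z, z \in X & z \in H],
        {in X &, injective d}
      & {in X &, forall x y, adj x y = ((d x).+1 == d y) || ((d y).+1 == d x)}].
Proof.
move=> conC sHC H0 vC; have [d [d0 lip pred_d]] := distance_to conC sHC H0.
suff [X [vX sXC conX XH [_ injd adjd]]] : exists X,
    [/\ v \in X, X \subset C, connected_set X, exists2 z, z \in X & z \in H &
      [/\ {in X, forall x, d x <= d v}, {in X &, injective d}
        & {in X &, forall x y, adj x y = ((d x).+1 == d y) || ((d y).+1 == d x)}]].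
  by exists d, X.
have [n] := ubnP (d v); elim: n v vC => // n IHn v vC; rewrite ltnS => dvn.
case dv: (d v) => [|m].
  exists [set v]; split; rewrite ?set11 ?sub1set //; first exact: connected_set1.
    by exists v; rewrite ?set11 // -d0 ?dv.
  split=> [x /set1P->|x y /set1P-> /set1P->|x y /set1P-> /set1P->] //.
    by rewrite dv.
  by rewrite adj_irrefl; lia.
have [y [yC vy dy]] := pred_d v vC m dv.
have [|X [yX sXC conX [z zX zH] [dX injd adjd]]] := IHn y yC; first by lia.
(* By [lip] a neighbour of [v] has distance at least [m], and [y] is the only such vertex of [X]. *)
have adjv x : x \in X -> adj v x = (d x == m).
  move=> xX; apply/idP/eqP => [vx|dx]; last by rewrite (injd x y) // dx dy.
  have := dX x xX; have := lip v x vC (subsetP sXC x xX) vx; lia.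
exists (v |: X); split.
- by rewrite setU11.
- by rewrite subUset sub1set vC.
- suff -> : v |: X = [set v; y] :|: X.
    by apply: (@connected_setU _ _ y); rewrite ?set22 //; apply: connected_set2.
  by rewrite -setUA [y |: X](setUidPr _) // sub1set.
- by exists z; rewrite // inE zX orbT.
split=> [x /setU1P[->|/dX]|x x' /setU1P[->|xX] /setU1P[->|x'X]|
         x x' /setU1P[->|xX] /setU1P[->|x'X]] //; rewrite ?dv //.
- by rewrite dy; lia.
- by have := dX x' x'X; lia.
- by have := dX x xX; lia.
- exact: injd.
- by rewrite adj_irrefl; lia.
- by rewrite adjv //; have := dX x' x'X; lia.
- by rewrite adj_sym adjv //; have := dX x xX; lia.
- exact: adjd.
Qed.

(** * Linear forests and paths *)

(* A linear forest is the same thing as an induced subgraph of the infinite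
   path on [nat]; this form makes subsets and disjoint unions immediate. *)
Definition linear_forest X := exists2 h : G -> nat, {in X &, injective h} &
  {in X &, forall x y, adj x y = ((h x).+1 == h y) || ((h y).+1 == h x)}.

Definition touch A B := [exists x in A, exists y in B, adj x y].

Lemma touchP A B :
  reflect (exists x y, [/\ x \in A, y \in B & adj x y]) (touch A B).
Proof.
apply: (iffP exists_inP) => [[x xA /exists_inP[y yB xy]]|[x [y [xA yB xy]]]].
  by exists x, y.
by exists x => //; apply/exists_inP; exists y.
Qed.

Lemma touchC A B : touch A B = touch B A.
Proof.
by apply/touchP/touchP => -[x [y [xA yB xy]]]; exists y, x; rewrite adj_sym.
Qed.

Lemma touchS A B A' B' :
  A \subset A' -> B \subset B' -> touch A B -> touch A' B'.
Proof.
move=> /subsetP sA /subsetP sB /touchP[x [y [xA yB xy]]].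
by apply/touchP; exists x, y; rewrite sA ?sB.
Qed.

Lemma linear_forestS A B : A \subset B -> linear_forest B -> linear_forest A.
Proof.
move=> /subsetP sAB [h injh adjh].
by exists h => x y xA yA; [apply: injh|apply: adjh]; rewrite ?sAB.
Qed.

Lemma linear_forestU A B :
  ~~ touch A B -> linear_forest A -> linear_forest B ->
  [disjoint A & B] -> linear_forest (A :|: B).
Proof.
move=> nAB [h injh adjh] [k injk adjk] dAB.
pose M := \max_(x in A) h x.
have hM x : x \in A -> h x <= M by move=> xA; apply: leq_bigmax_cond.
have noadj x y : x \in A -> y \in B -> adj x y = false.
  by move=> xA yB; apply: contraNF nAB => xy; apply/touchP; exists x, y.
have BA x : x \in B -> x \in A = false.
  by move=> xB; apply: contraTF xB => xA; rewrite (disjointFr dAB).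
(* Numbers on [A] are at most [M] and those on [B] at least [M.+2], so none of the former is next to
   one of the latter. *)
exists (fun x => if x \in A then h x else k x + M.+2) => x y.
- case/setUP => [xA|xB] /setUP[yA|yB]; rewrite ?xA ?yA ?(BA x) ?(BA y) //.
  + exact: injh.
  + by have := hM x xA; lia.
  + by have := hM y yA; lia.
  + by move/addIn; apply: injk.
case/setUP => [xA|xB] /setUP[yA|yB]; rewrite ?xA ?yA ?(BA x) ?(BA y) //.
- exact: adjh.
- by rewrite noadj //; have := hM x xA; lia.
- by rewrite adj_sym noadj //; have := hM y yA; lia.
- by rewrite adjk // -!addSn !eqn_add2r.
Qed.

(** Along an edge [h] changes by exactly one, so on a connected set its values fill an interval;
    subtracting the least value numbers the vertices as a path. *)
Lemma connected_linear_forest C :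
  connected_set C -> linear_forest C -> is_path (induced C).
Proof.
move=> conC [h injh adjh]; have [/set0Pn[x1 x1C] _] := conC.
case: (arg_minnP h x1C) => x0 x0C minh.
have hit x m : x \in C -> h x0 <= m <= h x -> exists2 z, z \in C & h z = m.
  move=> xC /andP[lem mle]; case: (ltngtP m (h x)) mle => // [ltm|->] _; last by exists x.
  have [||u [v [uC vC uv hu hv]]] :=
    connected_cut (p := fun z => h z <= m) conC x0C xC; rewrite -?ltnNge //.
  by exists u => //; move: uv hu hv; rewrite adjh //; lia.
(* All values from [h x0] to [h x] are attained on [C], so there are at most [#|C|] of them. *)
have bound x : x \in C -> h x - h x0 < #|C|.
  move=> xC; rewrite cardE -(size_map h) -(size_iota (h x0) (h x - h x0).+1).
  apply: uniq_leq_size; first exact: iota_uniq.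
  move=> m; rewrite mem_iota => mI.
  have [||z zC <-] := hit x m; rewrite //; first by have := minh x xC; lia.
  by apply/map_f; rewrite mem_enum.
exists #|C|; split; first by rewrite card_gt0; case: conC.
pose f (x : induced C) : path_graph #|C| := Ordinal (bound (val x) (valP x)).
exists f; split=> [|[x xC] [y yC]].
  apply: inj_card_bij; last by rewrite card_sig card_ord; apply/eq_leq/eq_card.
  move=> [x xC] [y yC] /(congr1 val) /= fxy; apply/val_inj/injh => //=.
  by have := minh x xC; have := minh y yC; lia.
rewrite /= /path_adj /induced_adj /= adjh //.
by have := minh x xC; have := minh y yC; lia.
Qed.

(** * Linking terminals by geodesics *)

(** The geodesic between the first two terminals needs no red vertex, and each further terminal adds
    at most one to the red set [R]. *)
Lemma steiner2 C x y s : connected_set C -> {subset x :: y :: s <= C} ->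
  exists H (R : {set G}), [/\ H \subset C, connected_set H, {subset x :: y :: s <= H},
    #|R| <= size s & linear_forest (H :\: R)].
Proof.
move=> conC; elim: s => [|v s IHs] sC.
  have xC : x \in C by rewrite sC ?inE ?eqxx.
  have yC : y \in C by rewrite sC ?inE ?eqxx ?orbT.
  have [|||d [X [[_ _ sXC] [yX conX [z zX zx]] injd adjd]]] :=
    @geodesic_to C [set x] y conC; rewrite ?sub1set //.
    by apply/set0Pn; exists x; rewrite set11.
  exists X, set0; split=> //; last by rewrite setD0; exists d.
    by move=> u; rewrite !inE => /orP[]/eqP-> //; rewrite -(set1P zx).
  by rewrite cards0.
have [|H [R [sHC conH sH cR lfH]]] := IHs.
  by move=> u us; apply: sC; move: us; rewrite !inE; lia.
have vC : v \in C by rewrite sC ?inE ?eqxx ?orbT.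
have [H0 _] := conH.
have [d [X [[d0 lip sXC] [vX conX [z zX zH]] injd adjd]]] :=
  geodesic_to conC sHC H0 vC.
(* Only the vertex of the geodesic at distance 1 can see [H] from outside. *)
pose W := [set w in X | d w == 1].
exists (H :|: X), (R :|: W); split.
- by rewrite subUset sHC.
- exact: connected_setU zH zX _ _.
- move=> u; rewrite !inE => /or4P[ux|uy|/eqP->|us].
  + by rewrite sH // inE ux.
  + by rewrite sH // !inE uy orbT.
  + by rewrite vX orbT.
  + by rewrite sH // !inE us !orbT.
- rewrite /= -addn1 (leq_trans (leq_card_setU _ _)) // leq_add //.
  apply/card_le1_eqP => u w; rewrite !inE => /andP[uX /eqP du] /andP[wX /eqP dw].
  by apply: injd; rewrite ?du.
(* By [lip] no vertex of [Y] has a neighbour in [H], so [Y] joins the linear forest [H :\: R] as a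
   separate piece. *)
pose Y := [set w in X | 1 < d w].
have sYC : Y \subset C.
  by apply/subsetP => u; rewrite inE => /andP[/(subsetP sXC)].
apply: (@linear_forestS _ ((H :\: R) :|: Y)).
  apply/subsetP => u; rewrite !inE negb_or negb_and.
  case/andP=> /andP[-> /= nuW] /orP[->//|uX].
  move: nuW; rewrite uX /=; have := d0 u (subsetP sXC u uX).
  by case: (u \in H) => //; lia.
apply: linear_forestU => //.
- apply/touchP => -[u [w [/setDP[uH _] wY uw]]].
  have wC := subsetP sYC w wY; have uC := subsetP sHC u uH.
  have := lip w u wC uC; rewrite adj_sym uw => /(_ isT).
  by move: (d0 u uC) wY; rewrite uH inE; lia.
- by exists d => u w; rewrite !inE => /andP[uX _] /andP[wX _];
    [apply: injd|apply: adjd].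
apply/pred0P => u /=; apply/negP => /andP[/setDP[uH _] uY].
have := d0 u (subsetP sHC u uH); move: uY; rewrite uH inE; lia.
Qed.

(** With fewer than two terminals, one vertex serves twice, and the truncated [size s - 2] is 0. *)
Lemma steiner C s : connected_set C -> {subset s <= C} ->
  exists H (R : {set G}), [/\ H \subset C, connected_set H, {subset s <= H},
    #|R| <= size s - 2 & linear_forest (H :\: R)].
Proof.
move=> conC; case: s => [|x [|y s]] sC.
- have [/set0Pn[x xC] _] := conC.
  have [|H [R [? ? ? ? ?]]] := @steiner2 C x x [::] conC; last by exists H, R.
  by move=> u; rewrite !inE orbb => /eqP->.
- have [|H [R [? ? sH ? ?]]] := @steiner2 C x x [::] conC.
    by move=> u; rewrite !inE orbb => /eqP->; apply: sC; rewrite inE.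
  exists H, R; split=> // u ux; apply: sH.
  by move: ux; rewrite !inE => ->.
have [H [R [? ? ? ? ?]]] := steiner2 conC sC.
by exists H, R; split; rewrite //= subn2.
Qed.

(** * Clique minors and chordal partitions *)

Lemma clique_minor t Q : t <= #|Q| -> {in Q, forall A, connected_set A} ->
  {in Q &, forall A B, A != B -> [disjoint A & B] /\ touch A B} ->
  minor (complete_graph t) G.
Proof.
move=> tQ conQ pairQ.
pose B (i : complete_graph t) : {set G} := enum_val (widen_ord tQ i).
have BQ i : B i \in Q by apply: enum_valP.
have Binj i j : i != j -> B i != B j.
  by apply: contra_neq => /enum_val_inj/(congr1 val)/= ij; apply: val_inj.
exists B; split=> [u|u v uv|u v uv]; first exact: conQ.
  by have [] := pairQ _ _ (BQ u) (BQ v) (Binj _ _ uv).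
have [_ /touchP[x [y xy]]] := pairQ _ _ (BQ u) (BQ v) (Binj _ _ uv).
by exists x, y.
Qed.

Lemma disjoint_notin_cover P A C x :
  [disjoint C & cover P] -> A \in P -> x \in C -> x \in A = false.
Proof.
move=> dC AP xC; apply: contraTF xC => xA; rewrite (disjointFl dC) //.
by apply/bigcupP; exists A.
Qed.

(* Each part added later touches a clique of earlier ones, so the quotient by
   such a partition is chordal. The set [r A] is the red set of the part [A]. *)
Definition chordal_partition t P (f : {set G} -> 'I_(t - 1))
    (r : {set G} -> {set G}) :=
  [/\ {in P, forall A, connected_set A}, trivIset P,
      {in P, forall A, #|r A| <= t - 4 /\ linear_forest (A :\: r A)},
      {in P &, forall A B, A != B -> touch A B -> f A != f B}
    & forall C, connected_set C -> [disjoint C & cover P] ->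
      {in P &, forall A B, A != B -> touch C A -> touch C B -> touch A B}].

(** The new part [H] touches every part that the component [C] touches. A connected set outside the
    new cover that touches [H] lies in [C], so the old parts it touches also touch [H], and the
    clique condition persists. *)
Lemma chordal_partition_step t P f r : 4 <= t -> ~ minor (complete_graph t) G ->
  @chordal_partition t P f r -> cover P != setT ->
  exists P' f' r', @chordal_partition t P' f' r' /\ cover P \proper cover P'.
Proof.
move=> t4 nminor [conP trivP rP fP chordP]; rewrite -subTset.
case/subsetPn => x0 _ x0P.
pose C := [set y in ~: cover P | connect (adj_in (~: cover P)) x0 y].
have x0C : x0 \in C by rewrite !inE x0P connect0.
have conC : connected_set C by apply: component_of_connected; rewrite inE.
have sCP : C \subset ~: cover P by apply/subsetP => y; rewrite inE => /andP[].
have dC : [disjoint C & cover P] by rewrite disjoints_subset.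
have maxC y z : y \in C -> z \notin cover P -> adj y z -> z \in C.
  rewrite !inE => /andP[yP x0y] zP yz; rewrite zP.
  by apply: connect_trans x0y (connect1 _); rewrite adj_inE !inE yP zP.
pose Q := [set A in P | touch C A].
have QP A : A \in Q -> A \in P by rewrite inE => /andP[].
have QC A : A \in Q -> touch C A by rewrite inE => /andP[].
have CP : C \notin P.
  by apply/negP => CP; have := disjoint_notin_cover dC CP x0C; rewrite x0C.
(* Otherwise [C] and the members of [Q] are at least [t] disjoint, connected, pairwise touching
   sets. *)
have cQ : #|Q| <= t - 2.
  have [leQ|ltQ] := leqP #|Q| (t - 2) => //; case: nminor.
  apply: (@clique_minor _ (C |: Q)); first by rewrite cardsU1 (contra (@QP C) CP); lia.
    by move=> A /setU1P[->//|/QP/conP].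
  have CA A : A \in Q -> [disjoint C & A].
    move=> /QP AP; apply/pred0P => x /=; apply/negP => /andP[xC xA].
    by rewrite (disjoint_notin_cover dC AP xC) in xA.
  move=> A B /setU1P[->|AQ] /setU1P[->|BQ]; rewrite ?eqxx // => AB.
  - by split; [apply: CA|apply: QC].
  - by rewrite disjoint_sym touchC; split; [apply: CA|apply: QC].
  split; first by apply: (trivIsetP trivP); rewrite ?QP.
  by apply: (chordP C) => //; rewrite ?QP ?QC.
(* The vertices [v A] are the terminals: with all of them in [H], the new part touches every member
   of [Q]. *)
have [v vP] : exists v : {set G} -> G, forall A, A \in Q ->
    v A \in C /\ touch [set v A] A.
  apply: (@fin_all_exists _ (fun=> G) (fun A x => A \in Q ->
    x \in C /\ touch [set x] A)) => A.
  have [/QC/touchP[x [y [xC yA xy]]]|] := boolP (A \in Q); last by exists x0.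
  by exists x => _; split=> //; apply/touchP; exists x, y; rewrite set11.
have [|H [R [sHC conH vH cR lfH]]] := @steiner C [seq v A | A <- enum Q] conC.
  by move=> x /mapP[A]; rewrite mem_enum => /vP[vA _] ->.
(* At most [t - 2] of the [t - 1] colours occur on [Q]. *)
have [col colP] : exists col, col \notin f @: Q.
  apply/existsP; rewrite -negb_forall; apply/negP => /forallP full.
  have fQ : f @: Q = setT by apply/setP => k; rewrite full inE.
  have := leq_trans (leq_imset_card f (mem Q)) cQ.
  by rewrite fQ cardsT card_ord; lia.
have [/set0Pn[h0 h0H] _] := conH.
have dH : [disjoint H & cover P] by apply: disjointWl dC.
have HP : H \notin P.
  by apply/negP => HP; have := disjoint_notin_cover dH HP h0H; rewrite h0H.
have neqH A : A \in P -> (A == H) = false.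
  by move=> AP; apply: contraNF HP => /eqP <-.
have HQ A : A \in Q -> touch H A.
  move=> AQ; have [_] := vP A AQ; apply: touchS => //.
  by rewrite sub1set vH // map_f // mem_enum.
have QH A : A \in P -> touch H A -> A \in Q.
  by move=> AP HA; rewrite inE AP (touchS _ _ HA).
have covH : cover (H |: P) = H :|: cover P by rewrite /cover bigcup_setU big_set1.
exists (H |: P), (fun A => if A == H then col else f A),
  (fun A => if A == H then R else r A); split; last first.
  rewrite covH properEneq subsetUr andbT; apply/eqP => /setP/(_ h0).
  by rewrite inE h0H (disjointFr dH).
split.
- by move=> A /setU1P[->|/conP].
- apply/trivIsetP => A B /setU1P[->|AP] /setU1P[->|BP]; rewrite ?eqxx // => AB.
  + apply/pred0P => x /=; apply/negP => /andP[xH xB].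
    by rewrite (disjoint_notin_cover dH BP xH) in xB.
  + apply/pred0P => x /=; apply/negP => /andP[xA xH].
    by rewrite (disjoint_notin_cover dH AP xH) in xA.
  + exact: (trivIsetP trivP).
- move=> A /setU1P[->|AP]; last by rewrite neqH //; apply: rP.
  rewrite eqxx; split=> //; apply: leq_trans cR _.
  by rewrite size_map -cardE (leq_trans (leq_sub2r 2 cQ)) -?subnDA.
- move=> A B /setU1P[->|AP] /setU1P[->|BP]; rewrite ?eqxx ?neqH // => AB.
  + by move=> /(QH _ BP) BQ; apply: contraNneq colP => ->; apply: imset_f.
  + rewrite touchC => /(QH _ AP) AQ.
    by apply: contraNneq colP => <-; apply: imset_f.
  + exact: fP.
move=> D conD; rewrite covH => dD.
have dDP : [disjoint D & cover P] by apply: disjointWr dD; rewrite subsetUr.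
(* [D] contains a neighbour of [H], which lies in [C]; avoiding [cover P], it cannot leave this
   component. *)
have sDC : touch D H -> D \subset C.
  move=> /touchP[x [y [xD yH xy]]].
  have xC : x \in C.
    by apply: (maxC y); rewrite ?(subsetP sHC) ?(disjointFr dDP) // adj_sym.
  apply/subsetP => z zD; apply/negPn/negP => zC.
  have [u [w [_ wD uw uC wC]]] :=
    connected_cut (p := mem C) conD xD zD xC zC.
  by case/negP: wC; apply: (maxC u); rewrite ?(disjointFr dDP).
move=> A B /setU1P[->|AP] /setU1P[->|BP]; rewrite ?eqxx // => AB.
- move=> /sDC sD DB; apply: HQ; rewrite inE BP.
  exact: touchS DB.
- move=> DA /sDC sD; rewrite touchC; apply: HQ; rewrite inE AP.
  exact: touchS DA.
- exact: (chordP D).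
Qed.

(** Every step enlarges the cover, so at most [#|G|] steps exhaust the graph. *)
Lemma chordal_partition_exists t : 4 <= t -> ~ minor (complete_graph t) G ->
  exists P f r, @chordal_partition t P f r /\ cover P = setT.
Proof.
move=> t4 nminor.
have t1 : 0 < t - 1 by lia.
suff grow n : exists P f r, @chordal_partition t P f r /\
    (cover P = setT \/ n <= #|cover P|).
  have [P [f [r [chP [cP|cP]]]]] := grow #|G|; exists P, f, r; split=> //.
  by apply/eqP; rewrite eqEcard subsetT cardsT.
elim: n => [|n [P [f [r [chP [cP|cP]]]]]].
- exists set0, (fun=> Ordinal t1), (fun=> set0); split; last by right.
  split; try by move=> A; rewrite inE.
    by apply/trivIsetP => A B; rewrite inE.
  by move=> C _ _ A B; rewrite inE.
- by exists P, f, r; split; last left.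
have [cT|nT] := eqVneq (cover P) setT; first by exists P, f, r; split; last left.
have [P' [f' [r' [chP' ltP]]]] := chordal_partition_step t4 nminor chP nT.
exists P', f', r'; split=> //; right.
exact: leq_ltn_trans (proper_card ltP).
Qed.

End Graph.

(** * The colouring *)

Theorem theorem12 (t : nat) (ht : 4 <= t) (G : sgraph)
    (hG : ~ minor (complete_graph t) G) :
  exists (c : G -> 'I_(2 * t - 2)) (S : {set 'I_(2 * t - 2)}),
    [/\ #|S| = t - 1,
        #|~: S| = t - 1,
        forall k C, k \in S -> C \in mono_components c k -> #|C| <= t - 4
      & forall k C, k \notin S -> C \in mono_components c k ->
          is_path (induced C)].
Proof.
have [P [f [r [[conP trivP rP fP _] coverP]]]] := chordal_partition_exists ht hG.
pose p x := pblock P x.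
have xp x : x \in p x by rewrite mem_pblock coverP inE.
have pP x : p x \in P by rewrite pblock_mem // coverP inE.
pose red x := x \in r (p x).
(* Red vertices use the colours below [t - 1] and the others a copy shifted by [t - 1], so a colour
   determines both redness and the value of [f]. *)
have cP x : (if red x then 0 else t - 1) + f (p x) < 2 * t - 2.
  by have := ltn_ord (f (p x)); case: ifP; lia.
pose c x : 'I_(2 * t - 2) := Ordinal (cP x).
have c_inj x y : c x = c y -> red x = red y /\ f (p x) = f (p y).
  move=> /(congr1 val) /=.
  have := ltn_ord (f (p x)); have := ltn_ord (f (p y)).
  by case: (red x); case: (red y) => ? ? ?; split=> //; try apply: val_inj => /=; lia.
pose S := [set k : 'I_(2 * t - 2) | k < t - 1].
have cS x : (c x \in S) = red x.
  by rewrite inE /=; have := ltn_ord (f (p x)); case: (red x); lia.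
have cardS : #|S| = t - 1.
  have le : t - 1 <= 2 * t - 2 by lia.
  rewrite (_ : S = widen_ord le @: setT).
    by rewrite card_imset ?cardsT ?card_ord // => i j /(congr1 val)/= ij; apply: val_inj.
  apply/setP => k; rewrite inE; apply/idP/imsetP => [kt|[i _ ->]] //=.
  by exists (Ordinal kt) => //; apply: val_inj.
(* A monochromatic component stays inside one part: an edge to another part would make two parts
   with equal [f] touch. *)
have mono k C : C \in mono_components c k -> exists x,
    [/\ connected_set C, k = c x & {in C, forall y, p y = p x /\ red y = red x}].
  case/componentsP => sC conC; have [/set0Pn[x xC] _] := conC; exists x.
  have Ck y : y \in C -> c y = k by move/(subsetP sC); rewrite inE => /eqP.
  split=> // [|y yC]; first by rewrite Ck.
  split; last by have [] := c_inj y x; rewrite ?Ck.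
  apply/eqP/negPn/negP => py.
  have [|u [w [uC wC uw /eqP pu pw]]] :=
    connected_cut (p := fun z => p z == p x) conC xC yC _ py => //.
  have [_ fuw] : red u = red w /\ f (p u) = f (p w) by apply: c_inj; rewrite !Ck.
  have /negP[] : f (p u) != f (p w); last by rewrite fuw.
  apply: fP => //; first by rewrite pu eq_sym.
  by apply/touchP; exists u, w.
exists c, S; split=> // [|k C kS /mono[x [conC kE xC]]|k C kS /mono[x [conC kE xC]]].
- by rewrite cardsCs setCK cardS card_ord; lia.
(* A red component lies in the red set of its part. *)
- have [+ _] := rP _ (pP x); apply: leq_trans; apply/subset_leq_card/subsetP => y yC.
  have [<- yx] := xC y yC; rewrite -[_ \in _]/(red y) yx -cS -kE //.
(* A non-red component is a connected subset of the linear forest left in its part. *)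
have [_ lf] := rP _ (pP x); apply: connected_linear_forest => //.
apply: linear_forestS lf; apply/subsetP => y yC; have [<- yx] := xC y yC.
by rewrite inE xp andbT -[_ \in r _]/(red y) yx -cS -kE.
Qed.
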